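(* Let $n \geq 1$ be an integer. The set $\mathcal{A}_{n-1}$ of approval ballot triangles of size $n-1$ is in bijection with the set of totally symmetric self-complementary plane partitions inside a $2n \times 2n \times 2n$ box.
   Context: An approval ballot triangle (ABT) of size $m$ is a triangular array $A(i,j)$, $1 \leq j \leq i \leq m$, with entries in $\{0,1\}$ satisfying the row compatibility condition $\sum_{k=j}^{i} A(i,k) \leq \sum_{k=j}^{i+1} A(i+1,k)$ for all $1 \leq j \leq i \leq m-1$. $\mathcal{A}_m$ denotes the set of ABTs of size $m$ (rows are indexed top-to-bottom, columns left-to-right). A plane partition inside a $2n\times 2n \times 2n$ box is a $2n \times 2n$ array $\pi(i,j)$ of integers in $\{0,\dots,2n\}$ that are weakly decreasing along rows and columns; viewed as a stack of unit cubes in $\mathbb{R}^3$, it is totally symmetric if the cube set is invariant under all permutations of the three coordinate axes, and self-complementary if it equals its complement in the box, i.e. $\pi(i,j) + \pi(2n+1-i,2n+1-j) = 2n$ for all $i,j$. Such objects are called TSSCPPs. *)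

(* Defs.v *)
From HB Require Import structures.
From mathcomp Require Import all_boot all_order all_fingroup all_algebra.

Set Implicit Arguments.
Unset Strict Implicit.
Unset Printing Implicit Defensive.

(* Indices are 0-based throughout: row i of a triangular array has the columns
   0, ..., i, and true / false stand for the entries 1 / 0. *)
Definition tri_array (m : nat) : finType :=
  {dffun forall i : 'I_m, {ffun 'I_i.+1 -> bool}}.

Definition is_ABT (m : nat) (A : tri_array m) : bool :=
  [forall i : 'I_m, forall i' : 'I_m, (i' == i.+1 :> nat) ==>
    [forall j : 'I_i.+1,
      \sum_(k < i.+1 | j <= k) A i k <= \sum_(k < i'.+1 | j <= k) A i' k]].

Definition ABT (m : nat) : finType := {A : tri_array m | is_ABT A}.

Definition box_array (N : nat) : finType := 'M['I_N.+1]_N.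

Definition is_plane_partition (N : nat) (p : box_array N) : bool :=
  [forall i : 'I_N, forall j : 'I_N, forall j' : 'I_N,
     (j <= j') ==> (p i j' <= p i j)]
  && [forall i : 'I_N, forall i' : 'I_N, forall j : 'I_N,
     (i <= i') ==> (p i' j <= p i j)].

(* A unit cube of the box is given by its three coordinates, as a function on
   the set 'I_3 of axes. *)
Definition cube (N : nat) : finType := {ffun 'I_3 -> 'I_N}.

Definition axis0 : 'I_3 := @Ordinal 3 0 isT.
Definition axis1 : 'I_3 := @Ordinal 3 1 isT.
Definition axis2 : 'I_3 := @Ordinal 3 2 isT.

Definition cubes (N : nat) (p : box_array N) : {set cube N} :=
  [set c : cube N | c axis2 < p (c axis0) (c axis1)].

Definition permute_axes (N : nat) (s : 'S_3) (c : cube N) : cube N :=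
  [ffun a => c (s a)].

Definition totally_symmetric (N : nat) (p : box_array N) : bool :=
  [forall s : 'S_3, permute_axes s @: cubes p == cubes p].

Definition self_complementary (N : nat) (p : box_array N) : bool :=
  [forall i : 'I_N, forall j : 'I_N,
     p i j + p (rev_ord i) (rev_ord j) == N].

Definition is_TSSCPP (n : nat) (p : box_array (2 * n)) : bool :=
  [&& is_plane_partition p, totally_symmetric p & self_complementary p].

Definition TSSCPP (n : nat) : finType := {p : box_array (2 * n) | is_TSSCPP p}.

(* Main.v *)
Require Import Defs.
From mathcomp Require Import all_boot all_order all_fingroup all_algebra.
From mathcomp Require Import zify.

(** Centre the [2n]-box and split it into octants according to whether each
coordinate is low ([< n]) or high.  In a TSSCPP the all-low octant is full and
the all-high one is empty, and by symmetry and complementation everything is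
determined by the octant with one low and two high coordinates.  Its slices at
distance [c] from the centre in the low direction are symmetric Young diagrams
[D c], increasing in [c], and monotonicity across the octant boundaries says
exactly that [D c] lies in a [c] by [c] square.  A symmetric diagram in such a
square is a strict partition with parts at most [c] (the rows of its upper
half), that is, a [0]-[1] word of length [c]; the cells on its [d]-th diagonal
are counted by the sum of the word from position [d] on.  Hence [D c] is
contained in [D c.+1] iff the suffix sums of consecutive words are ordered,
which is the row compatibility condition of approval ballot triangles. *)

Set Implicit Arguments.
Unset Strict Implicit.
Unset Printing Implicit Defensive.

(** * Counting with boolean sums, and bijections obtained from relations *)

Lemma sum_bool_le (Q : nat -> bool) (a b : nat) :
  \sum_(a <= k < b) Q k <= b - a.
Proof.
rewrite -[leqRHS]muln1 -sum_nat_const_nat.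
by apply: leq_sum => k _; apply: leq_b1.
Qed.

(** A down-closed [Q] is an initial segment of [[0, N)], and the sum is its length. This serves both
    for diagonals of diagrams and for columns of cubes. *)
Lemma ltn_sum_downclosed (N : nat) (Q : nat -> bool) (z : nat) :
    (forall k k', k <= k' -> k' < N -> Q k' -> Q k) -> z < N ->
  (z < \sum_(0 <= k < N) Q k) = Q z.
Proof.
move=> Qdown ltzN; rewrite (@big_cat_nat _ _ _ z) //=; last exact: ltnW.
rewrite (big_ltn ltzN).
have sum_le : \sum_(0 <= k < z) Q k <= z.
  by rewrite -[leqRHS]subn0; apply: sum_bool_le.
case Qz: (Q z); last first.
  rewrite [X in _ + (_ + X)]big_nat_cond [X in _ + (_ + X)]big1.
    by rewrite !addn0 ltnNge sum_le.
  move=> k /andP[/andP[ltzk ltkN] _]; apply/eqP; rewrite eqb0.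
  by apply: contraFN Qz; apply: Qdown => //; apply: ltnW.
suff -> : \sum_(0 <= k < z) Q k = z by rewrite addnA addn1 ltn_addr.
rewrite -[RHS]subn0 -[RHS]muln1 -sum_nat_const_nat; apply: eq_big_nat => k.
by move=> /andP[_ ltkz]; rewrite (Qdown k z) // ltnW.
Qed.

(** Choosing a partner on each side gives two maps, mutually inverse by uniqueness. The
    correspondence can thus be specified by a relation, with existence and uniqueness proved
    separately. *)
Lemma bijective_of_relation (S T : choiceType) (R : S -> T -> bool) :
    (forall x, exists y, R x y) -> (forall y, exists x, R x y) ->
    (forall x y y', R x y -> R x y' -> y = y') ->
    (forall x x' y, R x y -> R x' y -> x = x') ->
  exists f : S -> T, bijective f.
Proof.
move=> totl totr uniqr uniql; exists (fun x => xchoose (totl x)).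
exists (fun y => xchoose (totr y)) => [x|y].
  by apply: uniql (xchooseP (totr _)) (xchooseP (totl x)).
by apply: uniqr (xchooseP (totl _)) (xchooseP (totr y)).
Qed.

(** * Rows of a triangle and their suffix sums *)

(* Rows are numbered from 1 here, so that row [c] has [c] entries. *)
Definition entry (m : nat) (A : tri_array m) (c k : nat) : bool :=
  if insub c.-1 is Some i then
    if insub k is Some j then A i j else false
  else false.

Lemma entryE (m : nat) (A : tri_array m) (i : 'I_m) (k : 'I_i.+1) :
  entry A i.+1 k = A i k.
Proof. by rewrite /entry /= valK valK. Qed.

Lemma tri_array_eq (m : nat) (A B : tri_array m) :
    (forall c k, 0 < c <= m -> k < c -> entry A c k = entry B c k) -> A = B.
Proof.
move=> eqAB; apply/(@ffunP 'I_m _ A B) => i; apply/ffunP => k.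
by rewrite -!entryE; apply: eqAB; rewrite ltn_ord.
Qed.

Definition suffix_sum (b : nat -> bool) (c d : nat) : nat :=
  \sum_(d <= k < c) b k.

Lemma suffix_sum_recl (b : nat -> bool) (c d : nat) :
  d < c -> suffix_sum b c d = b d + suffix_sum b c d.+1.
Proof. exact: big_ltn. Qed.

Lemma suffix_sum_geq (b : nat -> bool) (c d : nat) :
  c <= d -> suffix_sum b c d = 0.
Proof. exact: big_geq. Qed.

Lemma suffix_sum_step (b : nat -> bool) (c d : nat) :
  suffix_sum b c d.+1 <= suffix_sum b c d <= (suffix_sum b c d.+1).+1.
Proof.
case: (ltnP d c) => [ltdc|lecd].
  by rewrite (suffix_sum_recl _ ltdc); case: (b d) => /=; lia.
by rewrite !suffix_sum_geq // ltnW.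
Qed.

Lemma suffix_sum_le (b : nat -> bool) (c d : nat) : suffix_sum b c d <= c - d.
Proof. exact: sum_bool_le. Qed.

(** The drops of [t] are 0 or 1, so the truth value of [t k.+1 < t k] is the difference
    [t k - t k.+1], and the sum telescopes to [t d - t c] with [t c = 0]. *)
Lemma suffix_sum_descent (t : nat -> nat) (c d : nat) :
    (forall e, t e.+1 <= t e <= (t e.+1).+1) -> (forall e, c <= e -> t e = 0) ->
  suffix_sum (fun k => t k.+1 < t k) c d = t d.
Proof.
move=> tstep t0; move: {-1}(c - d) (erefl (c - d)) => e.
elim: e d => [|e IHe] d cdE; first by rewrite suffix_sum_geq ?t0; lia.
rewrite suffix_sum_recl ?IHe; try lia.
by have := tstep d; case: ltnP => /=; lia.
Qed.

Lemma suffix_sum_entryE (m : nat) (A : tri_array m) (i : 'I_m) (d : nat) :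
  \sum_(k < i.+1 | d <= k) A i k = suffix_sum (entry A i.+1) i.+1 d.
Proof.
under eq_bigr do rewrite -entryE.
rewrite /suffix_sum -(big_mkord (leq d) (fun k => entry A i.+1 k : nat)).
case: (leqP d i.+1) => ledi; last first.
  rewrite [RHS]big_geq ?(ltnW ledi) // big_nat_cond big1 // => k; lia.
rewrite (@big_cat_nat _ _ _ d) //= big_nat_cond big1 ?add0n; last by lia.
rewrite big_nat_cond [RHS]big_nat_cond; apply: eq_bigl => k; lia.
Qed.

Lemma is_ABT_suffix_sum (m : nat) (A : tri_array m) :
  is_ABT A <->
  (forall c d, 0 < c < m ->
     suffix_sum (entry A c) c d <= suffix_sum (entry A c.+1) c.+1 d).
Proof.
split=> [ABTA [//|c] d /= ltcm|sufA].
  case: (ltnP d c.+1) => [ltdc|ledc]; last by rewrite (suffix_sum_geq _ ledc).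
  have /forallP/(_ (Ordinal (ltnW ltcm)))/forallP/(_ (Ordinal ltcm)) := ABTA.
  rewrite eqxx implyTb => /forallP/(_ (Ordinal ltdc)).
  by rewrite !suffix_sum_entryE.
apply/forallP => i; apply/forallP => i'; apply/implyP => /eqP i'E.
apply/forallP => j; rewrite !suffix_sum_entryE i'E; apply: sufA.
by rewrite /= -i'E.
Qed.

(** * Symmetric diagrams and nested families of them *)

(* The symmetric diagram whose cells on the [d]-th diagonal above the main one
   are the first [t d]. *)
Definition diagram (t : nat -> nat) (x y : nat) : bool :=
  minn x y < t (x - y + (y - x)).

Lemma diagramE (t : nat -> nat) (x d : nat) :
  diagram t x (x + d) = (x < t d).
Proof. by rewrite /diagram; congr (_ < t _); lia. Qed.

Lemma diagramC (t : nat -> nat) (x y : nat) : diagram t x y = diagram t y x.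
Proof. by rewrite /diagram minnC addnC. Qed.

(** Lower [y] one unit at a time. On or above the main diagonal the minimum stays and the diagonal
    index decreases, so [t] does not drop; below it both the minimum decreases and the index grows
    by 1, and [t] drops by at most 1. *)
Lemma diagram_down (t : nat -> nat) (x y y' : nat) :
    (forall d, t d.+1 <= t d <= (t d.+1).+1) ->
  y' <= y -> diagram t x y -> diagram t x y'.
Proof.
move=> tstep; elim: y => [|y IHy]; first by rewrite leqn0 => /eqP->.
rewrite leq_eqVlt => /orP[/eqP-> //|]; rewrite ltnS => ley'y Dy.
apply: IHy => //; move: Dy; rewrite /diagram; case: (leqP x y) => lexy.
  have := tstep (x - y + (y - x)).
  by rewrite (_ : x - y.+1 + (y.+1 - x) = (x - y + (y - x)).+1); lia.
have := tstep (x - y.+1 + (y.+1 - x)).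
by rewrite (_ : x - y + (y - x) = (x - y.+1 + (y.+1 - x)).+1); lia.
Qed.

Lemma diagram_bound (t : nat -> nat) (c x y : nat) :
  (forall d, t d <= c - d) -> diagram t x y -> y < c.
Proof. by move=> tle; have := tle (x - y + (y - x)); rewrite /diagram; lia. Qed.

Record nested_diagrams (n : nat) (D : nat -> nat -> nat -> bool) : Prop := {
  nestedC : forall c x y, c < n -> x < n -> y < n -> D c x y = D c y x;
  nested_bound : forall c x y, c < n -> x < n -> y < n -> D c x y -> y < c;
  nested_down : forall c x y y', c < n -> x < n -> y < n -> y' <= y ->
    D c x y -> D c x y';
  nested_incl : forall c c' x y, c' < n -> x < n -> y < n -> c <= c' ->
    D c x y -> D c' x y }.

Definition ABT_diagram (m : nat) (A : tri_array m) (c : nat) :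
  nat -> nat -> bool := diagram (suffix_sum (entry A c) c).

Lemma ABT_nested (m : nat) (A : tri_array m) :
  is_ABT A -> nested_diagrams m.+1 (ABT_diagram A).
Proof.
move=> /is_ABT_suffix_sum sufA; split.
- by move=> c x y _ _ _; apply: diagramC.
- by move=> c x y _ _ _; apply: diagram_bound => d; apply: suffix_sum_le.
- by move=> c x y y' _ _ _; apply: diagram_down => d; apply: suffix_sum_step.
move=> c c' x y ltc'; rewrite /ABT_diagram /diagram => _ _ lecc' Dc.
apply: leq_trans Dc _; move: (_ - _ + _) => d.
elim: c' ltc' lecc' => [|c' IHc] ltc'; first by rewrite leqn0 => /eqP->.
rewrite leq_eqVlt => /orP[/eqP-> //|]; rewrite ltnS => lecc'.
apply: leq_trans (IHc (ltnW ltc') lecc') _.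
(* The passage from row 0 to row 1 is not covered by [sufA], but row 0 is empty and its suffix sums
   vanish. *)
by case: c' ltc' {IHc lecc'} => [|c'] ltc'; [rewrite suffix_sum_geq | apply: sufA].
Qed.

(** * Recovering a triangle from the diagonals of a nested family *)

Section DiagramToRow.

Variables (n : nat) (D : nat -> nat -> nat -> bool).
Hypothesis nestedD : nested_diagrams n D.

Definition diagonal_length (c d : nat) : nat :=
  \sum_(0 <= x < n - d) D c x (x + d).

Lemma diagonal_lengthE (c x d : nat) : c < n -> x + d < n ->
  (x < diagonal_length c d) = D c x (x + d).
Proof.
move=> ltcn ltxdn.
apply: (@ltn_sum_downclosed (n - d) (fun x => D c x (x + d))); last by lia.
move=> k k' lekk' ltk' Dk'.
have Dk'k : D c k' (k + d) by apply: (nested_down nestedD) Dk'; lia.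
rewrite (nestedC nestedD) in Dk'k; try lia.
by rewrite (nestedC nestedD); try lia; apply: (nested_down nestedD) Dk'k; lia.
Qed.

Lemma diagonal_length_le (c d : nat) : diagonal_length c d <= n - d.
Proof.
rewrite -[leqRHS]subn0.
exact: (sum_bool_le (fun x => D c x (x + d))).
Qed.

(** The cell [(x, x + d.+1)] forces [(x, x + d)], and [(x.+1, x.+1 + d)] forces [(x, x + d.+1)]:
    each bound shifts the last cell of a diagonal by one unit in one coordinate. *)
Lemma diagonal_length_step (c d : nat) : c < n ->
  diagonal_length c d.+1 <= diagonal_length c d <= (diagonal_length c d.+1).+1.
Proof.
move=> ltcn; apply/andP; split.
  case E: (diagonal_length c d.+1) => [//|x].
  have := diagonal_length_le c d.+1; rewrite E => lexn.
  rewrite diagonal_lengthE; try lia.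
  have : x < diagonal_length c d.+1 by rewrite E.
  rewrite diagonal_lengthE; try lia.
  by apply: (nested_down nestedD); lia.
case E: (diagonal_length c d) => [//|[//|x]]; rewrite ltnS.
have := diagonal_length_le c d; rewrite E => lexn.
have : x.+1 < diagonal_length c d by rewrite E.
rewrite !diagonal_lengthE; try lia.
rewrite (nestedC nestedD); try lia.
rewrite [D c x _](nestedC nestedD); try lia.
by rewrite addSnnS; apply: (nested_down nestedD); lia.
Qed.

Lemma diagonal_length_geq (c d : nat) : c < n -> c <= d ->
  diagonal_length c d = 0.
Proof.
move=> ltcn lecd; rewrite /diagonal_length big_nat big1 // => x ltx.
apply/eqP; rewrite eqb0; apply/negP => /(nested_bound nestedD); lia.
Qed.

End DiagramToRow.

Lemma ABT_of_nested (m : nat) (D : nat -> nat -> nat -> bool) :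
    nested_diagrams m.+1 D ->
  exists2 A : tri_array m, is_ABT A &
    forall c x y, c < m.+1 -> x < m.+1 -> y < m.+1 ->
      ABT_diagram A c x y = D c x y.
Proof.
move=> nestedD; pose t := diagonal_length m.+1 D.
(* An entry is 1 exactly where the diagonal length drops, so by [suffix_sum_descent] the suffix sums
   are the diagonal lengths. *)
pose A : tri_array m :=
  [ffun i : 'I_m => [ffun k : 'I_i.+1 => t i.+1 k.+1 < t i.+1 k]].
have sufA c d : c < m.+1 -> suffix_sum (entry A c) c d = t c d.
  move=> ltcm; rewrite -(@suffix_sum_descent (t c) c d); first last.
  - by move=> e; apply: diagonal_length_geq.
  - by move=> e; apply: diagonal_length_step.
  apply: eq_big_nat => k /andP[_ ltkc]; congr nat_of_bool.
  case: c ltcm ltkc => // c ltcm ltkc.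
  by rewrite (@entryE _ A (@Ordinal m c ltcm) (Ordinal ltkc)) !ffunE.
exists A; last first.
  move=> c x y ltcm ltx lty; wlog lexy : x y ltx lty / x <= y => [hwlog|].
    case: (leqP x y) => [|/ltnW]; first exact: hwlog.
    by rewrite (nestedC nestedD) // /ABT_diagram diagramC; apply: hwlog.
  rewrite /ABT_diagram -(subnKC lexy) diagramE sufA //.
  by rewrite diagonal_lengthE ?subnKC.
apply/is_ABT_suffix_sum => c d ltcm; rewrite !sufA; try lia.
rewrite /t /diagonal_length big_nat [leqRHS]big_nat; apply: leq_sum => x ltx.
by case Dx: (D c x _) => //=; rewrite (nested_incl nestedD _ _ _ _ Dx) //; lia.
Qed.

Lemma ABT_diagram_inj (m : nat) (A B : tri_array m) :
    (forall c x y, c < m.+1 -> x < m.+1 -> y < m.+1 ->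
      ABT_diagram A c x y = ABT_diagram B c x y) ->
  A = B.
Proof.
move=> eqD.
have eq_suf c d : c < m.+1 -> suffix_sum (entry A c) c d = suffix_sum (entry B c) c d.
  move=> ltcm; have lt_eq x : x + d < m.+1 ->
      (x < suffix_sum (entry A c) c d) = (x < suffix_sum (entry B c) c d).
    by move=> ltxd; rewrite -!diagramE; apply: eqD; lia.
  have leA := suffix_sum_le (entry A c) c d; have leB := suffix_sum_le (entry B c) c d.
  (* If the two sums differed, [lt_eq] would fail at the smaller one, which is in range because the
     larger is at most [c - d]. *)
  case: (ltngtP (suffix_sum (entry A c) c d) (suffix_sum (entry B c) c d)) => // lt.
    by have := lt_eq (suffix_sum (entry A c) c d); rewrite lt ltnn; lia.
  by have := lt_eq (suffix_sum (entry B c) c d); rewrite lt ltnn; lia.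
apply: tri_array_eq => c k ltc ltkc.
have := eq_suf c k; rewrite !(suffix_sum_recl _ ltkc) eq_suf; last by lia.
by move=> /(_ ltac:(lia)); case: (entry A c k); case: (entry B c k) => //=; lia.
Qed.

(** * Plane partitions as sets of cells with natural coordinates *)

Definition cell (N : nat) (p : box_array N) (x y z : nat) : bool :=
  if insub x is Some i then
    if insub y is Some j then z < p i j else false
  else false.

Lemma cellE (N : nat) (p : box_array N) (i j : 'I_N) (z : nat) :
  cell p i j z = (z < p i j).
Proof. by rewrite /cell !valK. Qed.

Lemma box_array_eq (N : nat) (p q : box_array N) :
    (forall x y z, x < N -> y < N -> z < N -> cell p x y z = cell q x y z) ->
  p = q.
Proof.
move=> eqpq; apply/matrixP => i j; apply/val_inj.
have lt_eq z : z < N -> (z < p i j) = (z < q i j).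
  by move=> ltzN; rewrite -!cellE; apply: eqpq.
have := ltn_ord (p i j); have := ltn_ord (q i j).
case: (ltngtP (p i j : nat) (q i j)) => // lt.
  by have := lt_eq (p i j); rewrite lt ltnn; lia.
by have := lt_eq (q i j); rewrite lt ltnn; lia.
Qed.

(* [I x y z] says that the unit cube [(x, y, z)] belongs to the stack. *)
Record ideal_SSC (N : nat) (I : nat -> nat -> nat -> bool) : Prop := {
  ideal_down : forall x y z z', x < N -> y < N -> z' < N -> z <= z' ->
    I x y z' -> I x y z;
  ideal_swap01 : forall x y z, x < N -> y < N -> z < N -> I x y z = I y x z;
  ideal_swap12 : forall x y z, x < N -> y < N -> z < N -> I x y z = I x z y;
  ideal_compl : forall x y z, x < N -> y < N -> z < N ->
    I (N - x.+1) (N - y.+1) (N - z.+1) = ~~ I x y z }.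

Lemma eq_ideal_SSC (N : nat) (I I' : nat -> nat -> nat -> bool) :
    (forall x y z, x < N -> y < N -> z < N -> I x y z = I' x y z) ->
  ideal_SSC N I -> ideal_SSC N I'.
Proof.
move=> eqI [down swap01 swap12 compl]; split=> [x y z z' ltx lty ltz lez|||].
- by rewrite -!eqI //; [apply: down | apply: leq_ltn_trans ltz].
- by move=> x y z ltx lty ltz; rewrite -!eqI //; apply: swap01.
- by move=> x y z ltx lty ltz; rewrite -!eqI //; apply: swap12.
by move=> x y z ltx lty ltz; rewrite -!eqI ?compl //; lia.
Qed.

(** The swaps bring each coordinate in turn to the third place, where [ideal_down] applies. *)
Lemma ideal_le (N : nat) (I : nat -> nat -> nat -> bool) (x y z x' y' z' : nat) :
    ideal_SSC N I -> x' < N -> y' < N -> z' < N ->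
  x <= x' -> y <= y' -> z <= z' -> I x' y' z' -> I x y z.
Proof.
move=> [down swap01 swap12 _] ltx' lty' ltz' lex ley lez.
have [ltx lty ltz] : [/\ x < N, y < N & z < N] by split; lia.
move=> /(down _ _ _ _ ltx' lty' ltz' lez).
rewrite swap12 // => /(down _ _ _ _ ltx' ltz lty' ley).
by rewrite swap12 // swap01 // swap12 // => /(down _ _ _ _ lty ltz ltx' lex);
   rewrite swap12 // swap01.
Qed.

Lemma permute_axes_inj (N : nat) (s : 'S_3) : injective (@permute_axes N s).
Proof.
move=> c c' /ffunP eqc; apply/ffunP => a.
by have := eqc ((s^-1)%g a); rewrite !ffunE permKV.
Qed.

(** Permuting axes is injective, so an image contained in the finite set [cubes p] equals it by
    cardinality. *)
Lemma totally_symmetricE (N : nat) (p : box_array N) :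
  totally_symmetric p <->
  (forall s c, c \in cubes p -> permute_axes s c \in cubes p).
Proof.
split=> [/forallP symp s c cp|symp].
  by rewrite -(eqP (symp s)); apply: imset_f.
apply/forallP => s; rewrite eqEcard (card_imset _ (@permute_axes_inj N s)).
by rewrite leqnn andbT; apply/subsetP => _ /imsetP[c cp ->]; apply: symp.
Qed.

Lemma in_cubes (N : nat) (p : box_array N) (c : cube N) :
  (c \in cubes p) = cell p (c axis0) (c axis1) (c axis2).
Proof. by rewrite inE cellE. Qed.

Lemma totally_symmetric_cell (N : nat) (p : box_array N) :
  totally_symmetric p <->
  (forall x y z, x < N -> y < N -> z < N -> cell p x y z = cell p y x z) /\
  (forall x y z, x < N -> y < N -> z < N -> cell p x y z = cell p x z y).
Proof.
split=> [/totally_symmetricE symp|[swap01 swap12]]; last first.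
  apply/totally_symmetricE => s c; rewrite !in_cubes !ffunE.
  have /andP[/andP[n01 n02] n12] :
      (s axis0 != s axis1) && (s axis0 != s axis2) && (s axis1 != s axis2).
    by rewrite !(inj_eq perm_inj).
  have axisP a : [\/ a = axis0, a = axis1 | a = axis2].
    by case: a => [[|[|[|//]]] lta]; [constructor 1 | constructor 2 |
      constructor 3]; apply: val_inj.
  (* Of the 27 triples of values, the inequalities leave the six permutations; each non-identity one
     is a product of the two adjacent swaps. *)
  move: n01 n02 n12.
  case: (axisP (s axis0)) => ->; case: (axisP (s axis1)) => ->;
    case: (axisP (s axis2)) => -> //= _ _ _.
  - by rewrite swap12.
  - by rewrite swap01.
  - by rewrite swap01 // swap12.
  - by rewrite swap12 // swap01.
  by rewrite swap01 // swap12 // swap01.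
pose triple (i j k : 'I_N) : cube N :=
  [ffun a => if a == axis0 then i else if a == axis1 then j else k].
have swap01 x y z : x < N -> y < N -> z < N -> cell p x y z -> cell p y x z.
  move=> ltx lty ltz.
  have := symp (tperm axis0 axis1)
    (triple (Ordinal ltx) (Ordinal lty) (Ordinal ltz)).
  by rewrite !in_cubes !ffunE tpermL tpermR tpermD //= !ffunE.
have swap12 x y z : x < N -> y < N -> z < N -> cell p x y z -> cell p x z y.
  move=> ltx lty ltz.
  have := symp (tperm axis1 axis2)
    (triple (Ordinal ltx) (Ordinal lty) (Ordinal ltz)).
  by rewrite !in_cubes !ffunE tpermL tpermR tpermD //= !ffunE.
by split=> x y z ltx lty ltz; apply/idP/idP; [apply: swap01 | apply: swap01 |
  apply: swap12 | apply: swap12].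
Qed.

Lemma is_TSSCPP_cell (n : nat) (p : box_array (2 * n)) :
  is_TSSCPP p <-> ideal_SSC (2 * n) (cell p).
Proof.
split=> [/and3P[_ /totally_symmetric_cell[swap01 swap12] scp]|Ip].
  have compl (i j : 'I_(2 * n)) z : z < 2 * n ->
      cell p (rev_ord i) (rev_ord j) (2 * n - z.+1) = ~~ cell p i j z.
    move=> ltz; have /forallP/(_ i)/forallP/(_ j)/eqP := scp.
    by rewrite !cellE; lia.
  have down (i j : 'I_(2 * n)) z z' : z <= z' -> cell p i j z' -> cell p i j z.
    by rewrite !cellE; lia.
  split=> // [x y z z' ltx lty _|x y z ltx lty].
    exact: (down (Ordinal ltx) (Ordinal lty)).
  exact: (compl (Ordinal ltx) (Ordinal lty)).
have cell_le (i j i' j' : 'I_(2 * n)) :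
    i <= i' -> j <= j' -> p i' j' <= p i j.
  move=> lei lej; rewrite leqNgt; apply/negP => lt.
  (* The cube at height [p i j] would lie in column [(i', j')], hence in column [(i, j)], just above
     its top. *)
  have ltN : p i j < 2 * n by have := ltn_ord (p i' j'); lia.
  have : cell p i j (p i j).
    by apply: (ideal_le Ip (ltn_ord i') (ltn_ord j') ltN); rewrite ?cellE.
  by rewrite cellE ltnn.
apply/and3P; split.
- apply/andP; split; apply/forallP => i; apply/forallP => j;
    by apply/forallP => k; apply/implyP => le; apply: cell_le.
- by apply/totally_symmetric_cell; split;
    [apply: ideal_swap01 Ip | apply: ideal_swap12 Ip].
apply/forallP => i; apply/forallP => j; apply/eqP.
have compl z : z < 2 * n ->
    (2 * n - z.+1 < p (rev_ord i) (rev_ord j)) = ~~ (z < p i j).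
  by move=> ltz; rewrite -!cellE; apply: (ideal_compl Ip).
(* The first missing height and the last filled one bound the opposite column from below and from
   above. *)
have := compl (p i j); have := compl (p i j).-1.
have := ltn_ord (p i j); have := ltn_ord (p (rev_ord i) (rev_ord j)); lia.
Qed.

Lemma TSSCPP_of_ideal (n : nat) (I : nat -> nat -> nat -> bool) :
    ideal_SSC (2 * n) I ->
  exists2 p : box_array (2 * n), is_TSSCPP p &
    forall x y z, x < 2 * n -> y < 2 * n -> z < 2 * n -> cell p x y z = I x y z.
Proof.
move=> II; pose N := 2 * n.
pose p : box_array N := (\matrix_(i, j) inord (\sum_(0 <= z < N) I i j z)%N)%R.
have cell_ord (i j : 'I_N) z : z < N -> cell p i j z = I i j z.
  move=> ltz; rewrite cellE mxE inordK.
    by apply: ltn_sum_downclosed => // k k' lek ltk; apply: (ideal_down II).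
  by rewrite ltnS -[leqRHS]subn0; apply: sum_bool_le.
have cellp x y z : x < N -> y < N -> z < N -> cell p x y z = I x y z.
  by move=> ltx lty; apply: (cell_ord (Ordinal ltx) (Ordinal lty)).
exists p => //; apply/is_TSSCPP_cell; apply: eq_ideal_SSC II => x y z *.
by rewrite cellp.
Qed.

(** * The octants of the centred box *)

Definition center_dist (n x : nat) : nat := if x < n then n - x.+1 else x - n.

(** The coordinate on its own side of the centre selects the slice. Octants with two low coordinates
    are complements of those with one, hence the negations; [center_dist] is unchanged by
    complementation. *)
Definition octant_ideal (n : nat) (D : nat -> nat -> nat -> bool)
    (x y z : nat) : bool :=
  let u := center_dist n in
  match x < n, y < n, z < n with
  | true, true, true => true
  | true, true, false => ~~ D (u z) (u x) (u y)
  | true, false, true => ~~ D (u y) (u x) (u z)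
  | false, true, true => ~~ D (u x) (u y) (u z)
  | true, false, false => D (u x) (u y) (u z)
  | false, true, false => D (u y) (u x) (u z)
  | false, false, true => D (u z) (u x) (u y)
  | false, false, false => false
  end.

Lemma center_dist_lt (n x : nat) : x < 2 * n -> center_dist n x < n.
Proof. by rewrite /center_dist; case: (ltnP x n); lia. Qed.

Lemma center_dist_compl (n x : nat) : x < 2 * n ->
  center_dist n (2 * n - x.+1) = center_dist n x.
Proof.
by rewrite /center_dist; case: (ltnP (2 * n - _)); case: (ltnP x n); lia.
Qed.

Lemma ltn_compl (n x : nat) : x < 2 * n -> (2 * n - x.+1 < n) = ~~ (x < n).
Proof. by lia. Qed.

Lemma center_dist_low (n x x' : nat) : x <= x' -> x' < n ->
  center_dist n x' <= center_dist n x.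
Proof. by rewrite /center_dist; case: (ltnP x n); case: (ltnP x' n); lia. Qed.

Lemma center_dist_high (n x x' : nat) : x <= x' -> n <= x ->
  center_dist n x <= center_dist n x'.
Proof. by rewrite /center_dist; case: (ltnP x n); case: (ltnP x' n); lia. Qed.

Lemma octant_ideal_SSC (n : nat) (D : nat -> nat -> nat -> bool) :
  nested_diagrams n D -> ideal_SSC (2 * n) (octant_ideal n D).
Proof.
move=> nestedD; split=> [x y z z' ltx lty ltz' lez|||].
- have ltz : z < 2 * n by apply: leq_ltn_trans ltz'.
  have ux := center_dist_lt ltx; have uy := center_dist_lt lty.
  have uz := center_dist_lt ltz; have uz' := center_dist_lt ltz'.
  have low := @center_dist_low n z z' lez.
  have high := @center_dist_high n z z' lez.
  rewrite /octant_ideal; case: (ltnP x n) => _; case: (ltnP y n) => _;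
    case: (ltnP z n) => hz; case: (ltnP z' n) => hz' //; try lia.
  + by apply: contra; apply: (nested_incl nestedD) => //; apply: high.
  + by apply: contra; apply: (nested_down nestedD) => //; apply: low.
  (* Here [z] crosses the centre: [Dx] bounds the distance of [y] strictly by that of [x], and [Dy]
     the reverse. *)
  + move=> Dx; apply/negP => Dy.
    move: Dx; rewrite (nestedC nestedD) // => /(nested_bound nestedD).
    move: Dy; rewrite (nestedC nestedD) // => /(nested_bound nestedD).
    by lia.
  + by apply: (nested_down nestedD) => //; apply: high.
  + by apply: contra; apply: (nested_down nestedD) => //; apply: low.
  + move=> Dy; apply/negP => Dx.
    move: Dx; rewrite (nestedC nestedD) // => /(nested_bound nestedD).
    move: Dy; rewrite (nestedC nestedD) // => /(nested_bound nestedD).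
    by lia.
  + by apply: (nested_down nestedD) => //; apply: high.
  by apply: (nested_incl nestedD) => //; apply: low.
- move=> x y z /center_dist_lt ux /center_dist_lt uy /center_dist_lt uz.
  rewrite /octant_ideal.
  by case: (x < n); case: (y < n); case: (z < n) => //; rewrite (nestedC nestedD).
- move=> x y z /center_dist_lt ux /center_dist_lt uy /center_dist_lt uz.
  rewrite /octant_ideal.
  by case: (x < n); case: (y < n); case: (z < n) => //; rewrite (nestedC nestedD).
move=> x y z ltx lty ltz; rewrite /octant_ideal !center_dist_compl ?ltn_compl //.
by case: (x < n); case: (y < n); case: (z < n); rewrite ?negbK.
Qed.

Definition octant_diagram (n : nat) (I : nat -> nat -> nat -> bool)
  (c x y : nat) : bool := I (n - c.+1) (n + x) (n + y).

Lemma octant_idealK (n : nat) (D : nat -> nat -> nat -> bool) (c x y : nat) :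
  c < n -> octant_diagram n (octant_ideal n D) c x y = D c x y.
Proof.
move=> ltc; rewrite /octant_diagram /octant_ideal /center_dist.
by do ![case: ltnP => ?; try lia]; congr D; lia.
Qed.

Lemma octant_diagram_nested (n : nat) (I : nat -> nat -> nat -> bool) :
  ideal_SSC (2 * n) I -> nested_diagrams n (octant_diagram n I).
Proof.
move=> II; rewrite /octant_diagram; split.
- by move=> c x y ltc ltx lty; apply: (ideal_swap12 II); lia.
- move=> c x y ltc ltx lty Ic; rewrite ltnNge; apply/negP => lecy.
  (* If [c <= y], this cell lies below [(n - c.+1, n + x, n + y)]. Reversing its coordinates gives
     the complement of that cell, and a cell and its complement cannot both belong to [I]. *)
  have Iy : I (n - y.+1) (n - x.+1) (n + c) by apply: (ideal_le II) Ic; lia.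
  have Ic' : I (n + c) (n - x.+1) (n - y.+1).
    rewrite (ideal_swap12 II) ?(ideal_swap01 II (x := n + c)); try lia.
    by rewrite (ideal_swap12 II) //; lia.
  have := ideal_compl II (x := n - c.+1) (y := n + x) (z := n + y).
  rewrite Ic (_ : 2 * n - (n - c.+1).+1 = n + c); last by lia.
  rewrite (_ : 2 * n - (n + x).+1 = n - x.+1); last by lia.
  rewrite (_ : 2 * n - (n + y).+1 = n - y.+1); last by lia.
  by rewrite Ic' => /(_ ltac:(lia) ltac:(lia) ltac:(lia)).
- by move=> c x y y' ltc ltx lty ley; apply: (ideal_le II); lia.
by move=> c c' x y ltc ltx lty lec; apply: (ideal_le II); lia.
Qed.

(** If a low cell were missing, its complement would be present; that complement dominates it
    coordinatewise. *)
Lemma ideal_SSC_low (n : nat) (I : nat -> nat -> nat -> bool) (x y z : nat) :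
  ideal_SSC (2 * n) I -> x < n -> y < n -> z < n -> I x y z.
Proof.
move=> II ltx lty ltz; apply/negPn/negP => nI.
have := ideal_compl II (x := x) (y := y) (z := z).
rewrite nI => /(_ ltac:(lia) ltac:(lia) ltac:(lia)).
by move=> /(ideal_le II (x := x) (y := y) (z := z)) IN; case/negP: nI; apply: IN; lia.
Qed.

(** Swaps settle exactly one low coordinate, and the full low octant settles none by
    complementation. Two or more low coordinates become at most one after complementation. *)
Lemma ideal_SSC_eq (n : nat) (I J : nat -> nat -> nat -> bool) :
    ideal_SSC (2 * n) I -> ideal_SSC (2 * n) J ->
    (forall c x y, c < n -> x < n -> y < n ->
      octant_diagram n I c x y = octant_diagram n J c x y) ->
  forall x y z, x < 2 * n -> y < 2 * n -> z < 2 * n -> I x y z = J x y z.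
Proof.
move=> II JJ eqIJ x y z.
have lhh a b c : a < n -> n <= b < 2 * n -> n <= c < 2 * n -> I a b c = J a b c.
  move=> lta /andP[leb ltb] /andP[lec ltc].
  have := eqIJ (n - a.+1) (b - n) (c - n); rewrite /octant_diagram.
  rewrite !subnKC // (_ : n - (n - a.+1).+1 = a); last by lia.
  by apply; lia.
have few_low a b c : a < 2 * n -> b < 2 * n -> c < 2 * n ->
    (a < n) + (b < n) + (c < n) <= 1 -> I a b c = J a b c.
  move=> lta ltb ltc; case: (ltnP a n) => [an|na] le1; first by apply: lhh; lia.
  move: le1; case: (ltnP b n) => [bn|nb] le1.
    by rewrite (ideal_swap01 II) // (ideal_swap01 JJ) //; apply: lhh; lia.
  move: le1; case: (ltnP c n) => [cn|nc] le1.
    rewrite (ideal_swap12 II) // (ideal_swap12 JJ) //.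
    by rewrite (ideal_swap01 II) // (ideal_swap01 JJ) //; apply: lhh; lia.
  apply: negb_inj; rewrite -(ideal_compl II) // -(ideal_compl JJ) //.
  by rewrite !(@ideal_SSC_low n); try lia.
move=> ltx lty ltz; case: (leqP ((x < n) + (y < n) + (z < n)) 1).
  exact: few_low.
move=> many_low; apply: negb_inj; rewrite -(ideal_compl II) //.
by rewrite -(ideal_compl JJ) //; apply: few_low; try lia; rewrite !ltn_compl //; lia.
Qed.

Theorem theorem1p1 (n : nat) (hn : 1 <= n) :
  exists f : ABT (n - 1) -> TSSCPP n, bijective f.
Proof.
(* With [n = m.+1] there are [m.+1] slices for [m] rows: slice 0 is the empty diagram of the empty
   row 0. *)
case: n hn => // m _; rewrite subn1 /=.
pose R (A : ABT m) (p : TSSCPP m.+1) :=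
  [forall c : 'I_m.+1, forall x : 'I_m.+1, forall y : 'I_m.+1,
    octant_diagram m.+1 (cell (val p)) c x y == ABT_diagram (val A) c x y].
have RP A p : reflect (forall c x y, c < m.+1 -> x < m.+1 -> y < m.+1 ->
    octant_diagram m.+1 (cell (val p)) c x y = ABT_diagram (val A) c x y) (R A p).
  apply: (iffP idP) => [Rp c x y ltc ltx lty|eqD].
    have /forallP/(_ (Ordinal ltc))/forallP/(_ (Ordinal ltx)) := Rp.
    by move=> /forallP/(_ (Ordinal lty))/eqP.
  by apply/forallP => c; apply/forallP => x; apply/forallP => y; apply/eqP/eqD.
apply: (@bijective_of_relation (ABT m) (TSSCPP m.+1) R).
- move=> A; have nestedA := ABT_nested (valP A).
  have [p TSSCPPp cellp] := TSSCPP_of_ideal (octant_ideal_SSC nestedA).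
  exists (Sub p TSSCPPp); apply/RP => c x y ltc ltx lty; rewrite SubK.
  rewrite -(octant_idealK (ABT_diagram (val A)) x y ltc).
  by apply: cellp; lia.
- move=> p; have /is_TSSCPP_cell Ip := valP p.
  have [A ABTA eqD] := ABT_of_nested (octant_diagram_nested Ip).
  by exists (Sub A ABTA); apply/RP => c x y *; rewrite SubK eqD.
- move=> A p q /RP Rp /RP Rq; apply/val_inj/box_array_eq.
  have /is_TSSCPP_cell Ip := valP p; have /is_TSSCPP_cell Iq := valP q.
  by apply: (ideal_SSC_eq Ip Iq) => c x y *; rewrite Rp ?Rq.
move=> A B p /RP RA /RP RB; apply/val_inj/ABT_diagram_inj => c x y *.
by rewrite -RA ?RB.
Qed.
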